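(* There is an absolute constant $c>0$ such that the following holds. Let $1/n\leq\zeta\leq 0.04$ and $\eta\in(0,1)$. Suppose there exists an $\epsilon$-differentially edge private algorithm such that for every balanced $x\in\{\pm1\}^n$, on input $\mathbf{G}\sim\mathrm{SBM}_n(d,\gamma,x)$, it outputs $\hat{x}(\mathbf{G})\in\{\pm1\}^n$ satisfying \[ \Pr\left(\mathrm{err}(\hat{x}(\mathbf{G}),x)<\zeta\right)\geq 1-\eta, \] where the probability is over both the algorithm and the random graph. Then \[ e^{2\epsilon}-1\geq c\left(\frac{\log(1/\zeta)}{\gamma d}+\frac{\log(1/\eta)}{\zeta n\gamma d}\right). \]
   Context: Stochastic block model: for $n\in\mathbb{N}$, $d>0$, $\gamma>0$ and $x\in\{\pm1\}^n$, $\mathbf{G}\sim\mathrm{SBM}_n(d,\gamma,x)$ is the random graph on vertex set $[n]$ in which each pair $\{i,j\}$ of distinct vertices is independently an edge with probability $(1+\gamma x_i x_j)\frac{d}{n}$ (parameters such that these are probabilities). A vector $x\in\{\pm1\}^n$ is balanced if $\sum_i x_i=0$. For $u,v\in\{\pm1\}^n$, $\mathrm{Ham}(u,v)$ is the number of differing coordinates and $\mathrm{err}(u,v):=\frac1n\min\{\mathrm{Ham}(u,v),\mathrm{Ham}(u,-v)\}$. Two graphs on $[n]$ are adjacent if their edge sets differ in exactly one edge; an algorithm $\mathcal M$ is $\epsilon$-differentially edge private if for all adjacent $G,G'$ and all output sets $S$, $\Pr[\mathcal M(G)\in S]\leq e^{\epsilon}\Pr[\mathcal M(G')\in S]$.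
   Formalization: The formal theorem also assumes n is even (otherwise no balanced x exists) and 1−η ≥ 1/n; for η extremely close to 1 the claim is false, since outputting a uniformly random sign vector is 0-private and succeeds with probability at least 2^{-n}. *)

(* Defs.v *)
From HB Require Import structures.
From mathcomp Require Import all_boot all_order all_algebra.
From mathcomp Require Import reals sequences exp.

Set Implicit Arguments.
Unset Strict Implicit.
Unset Printing Implicit Defensive.

Import Order.TTheory GRing.Theory Num.Theory.

Local Open Scope ring_scope.

(* Sign vectors {+1, -1}^n, encoded by booleans: [false] is +1, [true] is -1. *)
Definition signvec (n : nat) := {ffun 'I_n -> bool}.

Definition sgn (R : pzRingType) (n : nat) (x : signvec n) (i : 'I_n) : R :=
  (-1) ^+ x i.

Definition oppv (n : nat) (x : signvec n) : signvec n := [ffun i => ~~ x i].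

Lemma sgn_oppv (R : pzRingType) (n : nat) (x : signvec n) (i : 'I_n) :
  sgn R (oppv x) i = - sgn R x i.
Proof. by rewrite /sgn ffunE signrN. Qed.

Definition balanced (n : nat) (x : signvec n) : Prop :=
  \sum_(i < n) sgn int x i = 0.

Definition Ham (n : nat) (u v : signvec n) : nat := #|[set i | u i != v i]|.

Definition err (R : realType) (n : nat) (u v : signvec n) : R :=
  n%:R^-1 * (minn (Ham u v) (Ham u (oppv v)))%:R.

(* An unordered pair of distinct vertices is represented by (i, j), i < j; a
   simple graph on 'I_n is its set of edges. *)
Definition vpair (n : nat) := {p : 'I_n * 'I_n | (p.1 < p.2)%N}.

Definition graph (n : nat) := {set vpair n}.

Definition adjacent (n : nat) (G G' : graph n) : Prop :=
  #|(G :\: G') :|: (G' :\: G)| = 1%N.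

Record dist (R : realType) (T : finType) := Dist {
  pmf :> T -> R;
  pmf_ge0 : forall t, 0 <= pmf t;
  pmf_sum1 : \sum_t pmf t = 1
}.

Definition Pr (R : realType) (T : finType) (P : dist R T) (S : {set T}) : R :=
  \sum_(t in S) P t.

Definition edge_prob (R : realType) (n : nat) (d gamma : R) (x : signvec n)
    (e : vpair n) : R :=
  (1 + gamma * sgn R x (val e).1 * sgn R x (val e).2) * (d / n%:R).

Definition sbm_params (R : realType) (n : nat) (d gamma : R) : Prop :=
  forall (x : signvec n) (e : vpair n), 0 <= edge_prob d gamma x e <= 1.

(* Edges are independent, so the mass function is a product over all pairs. *)
Definition sbm_pmf (R : realType) (n : nat) (d gamma : R) (x : signvec n)
    (G : graph n) : R :=
  \prod_(e : vpair n)
    (if e \in G then edge_prob d gamma x e else 1 - edge_prob d gamma x e).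

Lemma sbm_pmf_ge0 (R : realType) (n : nat) (d gamma : R)
    (hp : sbm_params n d gamma) (x : signvec n) (G : graph n) :
  0 <= sbm_pmf d gamma x G.
Proof.
by apply: prodr_ge0 => e _; have /andP[p0 p1] := hp x e; case: ifP; rewrite ?subr_ge0.
Qed.

Lemma sbm_pmf_sum1 (R : realType) (n : nat) (d gamma : R) (x : signvec n) :
  \sum_(G : graph n) sbm_pmf d gamma x G = 1.
Proof.
transitivity (\prod_(e : vpair n) (edge_prob d gamma x e + (1 - edge_prob d gamma x e))).
  by rewrite bigA_distr; apply: eq_bigl => G; rewrite inE.
by apply: big1 => e _; rewrite addrC subrK.
Qed.

Definition SBM (R : realType) (n : nat) (d gamma : R)
    (hp : sbm_params n d gamma) (x : signvec n) : dist R (graph n) :=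
  Dist (sbm_pmf_ge0 hp x) (sbm_pmf_sum1 d gamma x).

(* A randomized algorithm with values in a finite type is identified with the
   map sending each input graph to the law of its output. *)
Definition algorithm (R : realType) (n : nat) (T : finType) :=
  graph n -> dist R T.

Definition edge_private (R : realType) (n : nat) (T : finType) (eps : R)
    (M : algorithm R n T) : Prop :=
  forall G G' : graph n, adjacent G G' ->
  forall S : {set T}, Pr (M G) S <= expR eps * Pr (M G') S.

(* Probability that the output of [M] lies in [S] when the input graph has law
   [P], over the draw of the graph and the internal randomness of [M]. *)
Definition Pr_run (R : realType) (n : nat) (T : finType)
    (P : dist R (graph n)) (M : algorithm R n T) (S : {set T}) : R :=
  \sum_(G : graph n) P G * Pr (M G) S.

(* Main.v *)
(* Fix a balanced x0 and let x be obtained by swapping k signs of each kind.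
   Coupling SBM(x) and SBM(x0) edge by edge with the maximal coupling, the number
   D of differing edges satisfies E[e^(eps D)] <= exp(8 gamma d k (e^eps - 1)).
   Group privacy gives p_G <= e^(eps D) p_G' for p_G = Pr(M G in S), hence
   p_G^2 <= e^(eps D) p_G', and Cauchy-Schwarz yields
     Pr_x(S)^2 <= exp(8 gamma d k (e^eps - 1)) Pr_x0(S).
   Let m = floor(zeta n). For the first term, sum this over all swaps with k = 3(m + 1),
   S being the success event of x: every output is a success for at most
   4 C(n, m) of the C(n/2, 3m + 3)^2 swaps, and the resulting gap beats the n^2 lost
   because Pr_x(S) >= 1 - eta is only known to be at least 1/n. For the second
   term, when eta <= 1/4, apply it to a single swap with k = m + 1 and the success event
   of x, which has probability at most eta under x0; when eta > 1/4, the second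
   term is dominated by the first. *)
Require Import Defs.
From HB Require Import structures.
From mathcomp Require Import all_boot all_order all_algebra.
From mathcomp Require Import reals sequences exp.
From mathcomp Require Import zify ring lra.

Set Implicit Arguments.
Unset Strict Implicit.
Unset Printing Implicit Defensive.

Import Order.TTheory GRing.Theory Num.Theory.

Local Open Scope ring_scope.

(** * Binomial estimates *)

Section Binomial.
Local Open Scope nat_scope.

(** While [3 * m.+1 <= n], the ratio of the binomials at [m.+1] and [m] is at least 2, so the sum is
    geometric. *)
Lemma sum_bin_le n m : 3 * m <= n -> \sum_(j < m.+1) 'C(n, j) <= 2 * 'C(n, m).
Proof.
elim: m => [|m IHm] h; first by rewrite big_ord_recr big_ord0 /= bin0.
rewrite big_ord_recr /=.
have {}IHm : \sum_(j < m.+1) 'C(n, j) <= 2 * 'C(n, m) by apply: IHm; lia.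
have e := mul_bin_left n m.
suff h1 : 2 * 'C(n, m) <= 'C(n, m.+1).
  by rewrite mulSn mul1n leq_add2r (leq_trans IHm).
rewrite -(leq_pmul2l (ltn0Sn m)) e mulnA leq_mul2r; apply/orP; right; lia.
Qed.

(** With [n = 2 * N] the left side is n^2 times the [4 * 'C(n, m)] bound on how many swaps share an
    output. Induction on [m] compares growth factors of the two sides. *)
Lemma bin_ball_le N m : 13 <= N -> 25 * m <= 2 * N ->
  16 * N ^ 2 * 'C(2 * N, m) <= 'C(N, 2 * m.+1) ^ 2.
Proof.
move=> N13; elim: m => [|m IHm] h.
  have e := mul_bin_left N 1; rewrite bin1 in e.
  have h1 : 4 * N <= 'C(N, 2) by nia.
  by rewrite bin0 muln1 muln1 (_ : 16 * N ^ 2 = (4 * N) ^ 2) ?leq_exp2r // expnMn.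
have {}IHm : 16 * N ^ 2 * 'C(2 * N, m) <= 'C(N, 2 * m.+1) ^ 2 by apply: IHm; lia.
have e := mul_bin_left (2 * N) m.
have e1 := mul_bin_left N (2 * m.+1).
have e2 := mul_bin_left N (2 * m.+1).+1.
rewrite (_ : 2 * m.+2 = (2 * m.+1).+2); last lia.
move: e e1 e2 IHm.
set a := 'C(2 * N, m); set b := 'C(2 * N, m.+1); set c := 'C(N, 2 * m.+1).
set c1 := 'C(N, (2 * m.+1).+1); set c2 := 'C(N, (2 * m.+1).+2) => e e1 e2 IHm.
pose s := m.+1; pose M := (2 * s).+2 * (2 * s).+1.
have e3 : M * c2 = (N - (2 * s).+1) * (N - 2 * s) * c.
  by rewrite /M -mulnA (mulnCA (2 * s).+2) e2 mulnCA e1; lia.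
(* [(2 * N - m) / s] is the growth factor on the left; on the right it is the square of
   [(N - (2 * s).+1) * (N - 2 * s) / M]. *)
have key : (2 * N - m) * M ^ 2 <= s * ((N - (2 * s).+1) * (N - 2 * s)) ^ 2.
  have hM : M <= 12 * s ^ 2.
    by rewrite /M; have : 0 < s by []; clear; clearbody s; nia.
  have h1 : 4 * N <= 5 * (N - 2 * s) by rewrite /s; lia.
  have h2 : 3 * N <= 4 * (N - (2 * s).+1) by rewrite /s; lia.
  have hN : 10 * s <= N by rewrite /s; lia.
  have hm : 2 * N - m <= 2 * N by lia.
  move: h1 h2 hN hm hM; set P := N - (2 * s).+1; set Q := N - 2 * s.
  move: (2 * N - m) => d; clearbody P Q M; clear e1 e2 e3; clearbody s.
  clear b c1 c2 e IHm => h1 h2 hN hm hM.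
  have h3 : 3 * N ^ 2 <= 5 * (P * Q) by have := leq_mul h1 h2; lia.
  have h4 : (3 * N ^ 2) ^ 2 <= (5 * (P * Q)) ^ 2 by rewrite leq_exp2r.
  have h5 : (10 * s) ^ 3 <= N ^ 3 by rewrite leq_exp2r.
  have h6 : M ^ 2 <= (12 * s ^ 2) ^ 2 by rewrite leq_exp2r.
  rewrite -(@leq_pmul2l 25) //.
  apply: (@leq_trans (25 * (2 * N * (12 * s ^ 2) ^ 2))).
    by rewrite leq_mul2l leq_mul.
  apply: (@leq_trans (s * (3 * N ^ 2) ^ 2)); last first.
    by rewrite mulnCA leq_mul2l -[25]/(5 ^ 2) -expnMn h4 orbT.
  (* The constants compare as 7200 against 9000 times [N * s ^ 4]; then [10 * s <= N] absorbs
     s^3. *)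
  apply: (@leq_trans (9 * (N * s * (10 * s) ^ 3))).
    have -> : 9 * (N * s * (10 * s) ^ 3) =
        25 * (2 * N * (12 * s ^ 2) ^ 2) + 1800 * (N * s ^ 4) by ring.
    exact: leq_addr.
  apply: (@leq_trans (9 * (N * s * N ^ 3))); first by rewrite !leq_mul2l h5 !orbT.
  by rewrite (_ : 9 * _ = s * (3 * N ^ 2) ^ 2) //; ring.
have M0 : 0 < s * M ^ 2 by rewrite /s /M; lia.
rewrite -(leq_pmul2l M0).
have -> : s * M ^ 2 * (16 * N ^ 2 * b) = (16 * N ^ 2 * a) * ((2 * N - m) * M ^ 2).
  rewrite (_ : s * M ^ 2 * (16 * N ^ 2 * b) = 16 * N ^ 2 * M ^ 2 * (m.+1 * b)).
    by rewrite e; lia.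
  by rewrite /s; lia.
have -> : s * M ^ 2 * c2 ^ 2 = c ^ 2 * (s * ((N - (2 * s).+1) * (N - 2 * s)) ^ 2).
  by rewrite -mulnA -expnMn e3 expnMn; lia.
exact: leq_mul.
Qed.

(** Each of the [m] unit steps from [a] to [a + m] multiplies the binomial by at least the last
    ratio, [(N - (a + m)) / (a + m)]. *)
Lemma bin_ratio_ge N a m : a + m <= N ->
  'C(N, a) * (N - (a + m)) ^ m <= 'C(N, a + m) * (a + m) ^ m.
Proof.
move=> h; suff H j : j <= m ->
    'C(N, a) * (N - (a + m)) ^ j <= 'C(N, a + j) * (a + m) ^ j by exact: H.
elim: j => [|j IHj] hj; first by rewrite !expn0 !muln1 addn0.
have {IHj}IHj := IHj (ltnW hj).
have e := mul_bin_left N (a + j).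
have h1 : (N - (a + m)) * 'C(N, a + j) <= (a + m) * 'C(N, (a + j).+1).
  apply: (@leq_trans ((N - (a + j)) * 'C(N, a + j))).
    by rewrite leq_mul2r; apply/orP; right; lia.
  by rewrite -e leq_mul2r; apply/orP; right; lia.
rewrite !expnSr mulnA addnS; apply: (leq_trans (leq_mul IHj (leqnn _))).
rewrite mulnAC [leqRHS]mulnA [leqRHS]mulnAC leq_mul2r.
by rewrite (mulnC 'C(N, a + j)) (mulnC 'C(N, (a + j).+1)) h1 orbT.
Qed.

End Binomial.

(** * Edgewise coupling and Cauchy-Schwarz *)

Section Coupling.
Variable R : realType.

(** Distributivity: a pair of subsets is a choice of two bits for each element. *)
Lemma sum_subsets2 (I : finType) (f : I -> bool -> bool -> R) :
  \sum_(G : {set I}) \sum_(H : {set I}) \prod_e f e (e \in G) (e \in H) =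
  \prod_e (f e true true + f e true false + f e false true + f e false false).
Proof.
transitivity (\sum_(G : {set I}) \prod_e
    (if e \in G then f e true true + f e true false
     else f e false true + f e false false)).
  apply: eq_bigr => G _.
  transitivity (\prod_e (f e (e \in G) true + f e (e \in G) false)); last first.
    by apply: eq_bigr => e _; case: (e \in G).
  rewrite bigA_distr [RHS](eq_bigl xpredT); last by move=> H; rewrite ?inE.
  by apply: eq_bigr => H _; apply: eq_bigr => e _; case: (e \in H).
transitivity (\prod_e ((f e true true + f e true false) +
                      (f e false true + f e false false))).
  by rewrite bigA_distr; apply: eq_bigl => G; rewrite ?inE.
by apply: eq_bigr => e _; rewrite !addrA.
Qed.

(** Both sides become sums over pairs [(s, t)]; once the right side is symmetrized, they compare
    term by term. *)
Lemma cauchy_schwarz_weighted (T : finType) (W p a b : T -> R) :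
  (forall t, 0 <= W t) -> (forall t, 0 <= a t) -> (forall t, 0 <= b t) ->
  (forall t, 0 <= p t) -> (forall t, p t ^+ 2 <= a t * b t) ->
  (\sum_t W t * p t) ^+ 2 <= (\sum_t W t * a t) * (\sum_t W t * b t).
Proof.
move=> W0 a0 b0 p0 pab.
set A := \sum_t W t * a t; set B := \sum_t W t * b t.
have e : A * B = \sum_s \sum_t W s * W t * ((a s * b t + a t * b s) / 2).
  transitivity ((A * B + B * A) / 2); first by field.
  rewrite /A /B !big_distrlr -big_split mulr_suml; apply: eq_bigr => s _ /=.
  by rewrite -big_split mulr_suml; apply: eq_bigr => t _ /=; field.
rewrite e expr2 big_distrlr; apply: ler_sum => s _; apply: ler_sum => t _ /=.
rewrite mulrACA; apply: ler_wpM2l; first exact: mulr_ge0.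
(* AM-GM: [p s * p t] is at most the geometric mean of [a s * b t] and [a t * b s]. *)
have h0 : 0 <= (a s * b t + a t * b s) / 2.
  by apply: divr_ge0 => //; apply: addr_ge0; apply: mulr_ge0.
rewrite -(@ler_pXn2r _ 2) ?nnegrE //; last exact: mulr_ge0.
have : p s ^+ 2 * p t ^+ 2 <= (a s * b s) * (a t * b t).
  by apply: ler_pM; rewrite ?exprn_ge0.
have := sqr_ge0 (a s * b t - a t * b s).
rewrite exprMn; nra.
Qed.

(* The maximal coupling of Bernoulli(p) and Bernoulli(q): the two coordinates
   differ with probability |p - q|. *)
Definition bern_coupling (p q : R) (a b : bool) : R :=
  if a then if b then Num.min p q else p - Num.min p q
  else if b then q - Num.min p q else 1 - p - q + Num.min p q.

Lemma bern_coupling_ge0 p q a b :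
  0 <= p <= 1 -> 0 <= q <= 1 -> 0 <= bern_coupling p q a b.
Proof. by rewrite /bern_coupling; case: a b => [] []; case: (lerP p q); lra. Qed.

Definition bern_set (I : finType) (p : I -> R) (G : {set I}) : R :=
  \prod_e (if e \in G then p e else 1 - p e).

(** Cauchy-Schwarz under the product coupling [W], with the privacy cost [D] as one factor; [D] is a
    product over elements, so its expectation factorizes. *)
Lemma bern_set_transfer (I : finType) (p q : I -> R) (w : R) (f : {set I} -> R) :
  (forall e, 0 <= p e <= 1) -> (forall e, 0 <= q e <= 1) -> 1 <= w ->
  (forall G, 0 <= f G <= 1) ->
  (forall G H : {set I}, f G <=
    (\prod_e (if (e \in G) == (e \in H) then 1 else w)) * f H) ->
  (\sum_G bern_set p G * f G) ^+ 2 <=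
    expR ((w - 1) * \sum_e `|p e - q e|) * \sum_H bern_set q H * f H.
Proof.
move=> hp hq w1 f01 fGH.
pose W (GH : {set I} * {set I}) : R :=
  \prod_e bern_coupling (p e) (q e) (e \in GH.1) (e \in GH.2).
pose D (GH : {set I} * {set I}) : R :=
  \prod_e (if (e \in GH.1) == (e \in GH.2) then 1 else w).
have W0 GH : 0 <= W GH by apply: prodr_ge0 => e _; exact: bern_coupling_ge0.
have D0 GH : 0 <= D GH by apply: prodr_ge0 => e _; case: ifP => _; lra.
have f0 G : 0 <= f G by case/andP: (f01 G).
have WG (G : {set I}) : \sum_H W (G, H) = bern_set p G.
  transitivity (\prod_e (bern_coupling (p e) (q e) (e \in G) true
                       + bern_coupling (p e) (q e) (e \in G) false)).
    rewrite bigA_distr [RHS](eq_bigl xpredT); last by move=> H; rewrite ?inE.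
    by apply: eq_bigr => H _; apply: eq_bigr => e _; rewrite /=; case: (e \in H).
  by apply: eq_bigr => e _; rewrite /bern_coupling; case: ifP => _; lra.
have WH (H : {set I}) : \sum_G W (G, H) = bern_set q H.
  transitivity (\prod_e (bern_coupling (p e) (q e) true (e \in H)
                       + bern_coupling (p e) (q e) false (e \in H))).
    rewrite bigA_distr [RHS](eq_bigl xpredT); last by move=> G; rewrite ?inE.
    by apply: eq_bigr => G _; apply: eq_bigr => e _; rewrite /=; case: (e \in G).
  by apply: eq_bigr => e _; rewrite /bern_coupling; case: ifP => _; lra.
have -> : \sum_G bern_set p G * f G = \sum_GH W GH * f GH.1.
  rewrite -(pair_bigA _ (fun G H => W (G, H) * f G)) /=.
  by apply: eq_bigr => G _; rewrite -mulr_suml WG.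
have -> : \sum_H bern_set q H * f H = \sum_GH W GH * f GH.2.
  rewrite -(pair_bigA _ (fun G H => W (G, H) * f H)) /= exchange_big /=.
  by apply: eq_bigr => H _; rewrite -mulr_suml WH.
apply: (le_trans (@cauchy_schwarz_weighted _ W _ D (fun GH => f GH.2) _ _ _ _ _)) => //.
  move=> [G H] /=; apply: le_trans (fGH G H).
  (* As [f] lies in [0, 1], its square is at most [f G], hence at most [D] times [f H]. *)
  by rewrite expr2 ler_piMr //; case/andP: (f01 G).
apply: ler_wpM2r; first by apply: sumr_ge0 => GH _; apply: mulr_ge0.
rewrite -(pair_bigA _ (fun G H => W (G, H) * D (G, H))) /=.
have -> : \sum_G \sum_H W (G, H) * D (G, H) =
    \prod_e (1 + (w - 1) * `|p e - q e|).
  pose g e a b := bern_coupling (p e) (q e) a b * (if a == b then 1 else w).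
  transitivity (\sum_(G : {set I}) \sum_(H : {set I}) \prod_e g e (e \in G) (e \in H)).
    by apply: eq_bigr => G _; apply: eq_bigr => H _; rewrite -big_split.
  rewrite (sum_subsets2 g); apply: eq_bigr => e _; rewrite /g /bern_coupling /=.
  by case: (lerP (p e) (q e)) => h; lra.
rewrite mulr_sumr expR_sum; apply: ler_prod => e _; rewrite expR_ge1Dx andbT.
by apply: addr_ge0 => //; apply: mulr_ge0 => //; lra.
Qed.

End Coupling.

(** * Group privacy and output probabilities *)

Section Probability.
Variables (R : realType) (n : nat).

Lemma Pr_ge0 (T : finType) (P : dist R T) (S : {set T}) : 0 <= Pr P S.
Proof. by apply: sumr_ge0 => t _; exact: pmf_ge0. Qed.

Lemma PrT (T : finType) (P : dist R T) : Pr P setT = 1.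
Proof. by rewrite -(pmf_sum1 P); apply: eq_bigl => t; rewrite inE. Qed.

Lemma PrU_disjoint_le1 (T : finType) (P : dist R T) (A B : {set T}) :
  [disjoint A & B] -> Pr P A + Pr P B <= 1.
Proof.
move=> dAB; rewrite -(PrT P) /Pr -bigU //=.
rewrite [leLHS]big_mkcond [leRHS]big_mkcond /=; apply: ler_sum => t _.
by rewrite in_setT; case: ifP => // _; exact: pmf_ge0.
Qed.

Lemma Pr_le1 (T : finType) (P : dist R T) (S : {set T}) : Pr P S <= 1.
Proof.
have := @PrU_disjoint_le1 _ P S set0; rewrite /Pr big_set0 addr0; apply.
by rewrite disjoint_sym; apply/pred0P => t; rewrite /= inE.
Qed.

Definition symd (I : finType) (G H : {set I}) := (G :\: H) :|: (H :\: G).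

Lemma in_symd (I : finType) (G H : {set I}) e :
  (e \in symd G H) = ((e \in G) != (e \in H)).
Proof. by rewrite !inE; case: (e \in G); case: (e \in H). Qed.

(** Toggle the differing edges one at a time. Writing the cost as a product over edges, not as a
    power, lets its expectation factorize under the coupling. *)
Lemma group_privacy (T : finType) (M : algorithm R n T) eps (S : {set T})
    (G H : graph n) : edge_private eps M ->
  Pr (M G) S <=
    (\prod_e (if (e \in G) == (e \in H) then 1 else expR eps)) * Pr (M H) S.
Proof.
move=> priv.
have -> : \prod_e (if (e \in G) == (e \in H) then 1 else expR eps) =
    expR eps ^+ #|symd G H|.
  rewrite -prodr_const [RHS]big_mkcond /=; apply: eq_bigr => e _.
  by rewrite in_symd; case: eqP.
move: {2}#|symd G H| (erefl #|symd G H|) => k.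
elim: k G => [|k IHk] G hk.
  rewrite hk expr0 mul1r (_ : G = H) //; apply/setP => e; apply/eqP.
  by have := in_symd G H e; rewrite (cards0_eq hk) inE => /esym/negbFE.
have /card_gt0P[e eGH] : (0 < #|symd G H|)%N by rewrite hk.
pose G1 := symd G [set e].
have adj : Defs.adjacent G G1.
  rewrite /Defs.adjacent -/(symd G G1) (_ : symd G G1 = [set e]) ?cards1 //.
  by apply/setP => f; rewrite /G1 !in_symd inE; case: (f \in G); case: (f == e).
have hk1 : #|symd G1 H| = k.
  rewrite (cardsD1 e) eGH in hk; case: hk => <-; apply: eq_card.
  move=> f; rewrite /G1 in_setD1 !in_symd inE.
  case: (eqVneq f e) eGH => [->|_ _]; last by case: (f \in G); case: (f \in H).
  by rewrite in_symd; case: (e \in G); case: (e \in H).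
apply: (le_trans (priv _ _ adj S)).
rewrite hk exprS -mulrA; apply: ler_wpM2l; first exact: expR_ge0.
by rewrite -[X in _ ^+ X]hk1 IHk.
Qed.

(** Applying privacy to the full output set, on a one-edge graph and the empty graph, gives
    [1 <= expR eps]. *)
Lemma edge_private_eps_ge0 (T : finType) (M : algorithm R n T) eps :
  (1 < n)%N -> edge_private eps M -> 0 <= eps.
Proof.
move=> n1 priv.
pose e : vpair n := Sub (Ordinal (ltnW n1), Ordinal n1) isT.
have adj : Defs.adjacent [set e] set0.
  by rewrite /Defs.adjacent setD0 set0D setU0 cards1.
by have := priv _ _ adj setT; rewrite !PrT mulr1 -expR0 ler_expR.
Qed.

Lemma Pr_runU_disjoint_le1 (T : finType) (P : dist R (graph n))
    (M : algorithm R n T) (A B : {set T}) :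
  [disjoint A & B] -> Pr_run P M A + Pr_run P M B <= 1.
Proof.
move=> dAB; rewrite /Pr_run -big_split -(pmf_sum1 P) /=; apply: ler_sum => G _.
by rewrite -mulrDr ler_piMr ?pmf_ge0 // PrU_disjoint_le1.
Qed.

(** Double counting: after exchanging sums, each output [t] is charged at most [b] times its
    mass. *)
Lemma sum_Pr_run_le (T : finType) (P : dist R (graph n)) (M : algorithm R n T)
    (I : finType) (A : {set I}) (S : I -> {set T}) (b : nat) :
  (forall t, (#|[set i in A | t \in S i]| <= b)%N) ->
  \sum_(i in A) Pr_run P M (S i) <= b%:R.
Proof.
move=> hb; rewrite /Pr_run exchange_big /=.
apply: (@le_trans _ _ (\sum_G P G * b%:R)); last first.
  by rewrite -mulr_suml pmf_sum1 mul1r.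
apply: ler_sum => G _; rewrite -mulr_sumr; apply: ler_wpM2l; first exact: pmf_ge0.
under eq_bigr do rewrite /Pr big_mkcond /=.
rewrite exchange_big /=.
apply: (@le_trans _ _ (\sum_t M G t * b%:R)); last first.
  by rewrite -mulr_suml pmf_sum1 mul1r.
apply: ler_sum => t _; rewrite -big_mkcondr /=.
rewrite (eq_bigl [in [set i in A | t \in S i]]); last by move=> i; rewrite inE.
rewrite sumr_const -[M G t *+ _]mulr_natr.
by apply: ler_wpM2l; rewrite ?pmf_ge0 // ler_nat.
Qed.

End Probability.

(** * Changing signs in the block model *)

Section SBM.
Variables (R : realType) (n : nat) (d gamma : R) (hp : sbm_params n d gamma).
Hypotheses (n_gt0 : (0 < n)%N) (d_ge0 : 0 <= d) (gamma_ge0 : 0 <= gamma).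

Definition flip (U : {set 'I_n}) (x : signvec n) : signvec n :=
  [ffun i => x i (+) (i \in U)].

Lemma edge_prob_flip x U e :
  `|edge_prob d gamma (flip U x) e - edge_prob d gamma x e| <=
  2 * gamma * (d / n%:R) * (((val e).1 \in U) || ((val e).2 \in U))%:R.
Proof.
have h : 0 <= gamma * (d / n%:R) by rewrite mulr_ge0 // divr_ge0.
rewrite /edge_prob /sgn !ffunE; move: ((val e).1) ((val e).2) => i j.
case: (i \in U); case: (j \in U); case: (x i); case: (x j) => /=;
  rewrite ?expr0 ?expr1; rewrite ler_norml; lra.
Qed.

(** At most [2 * #|U| * n] pairs meet [U], and each changes its edge probability by at most
    [2 * gamma * d / n]. *)
Lemma sum_edge_prob_flip x U :
  \sum_e `|edge_prob d gamma (flip U x) e - edge_prob d gamma x e| <=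
  4 * gamma * d * #|U|%:R.
Proof.
apply: (le_trans (ler_sum _ (fun e _ => edge_prob_flip x U e))).
rewrite -mulr_sumr -natr_sum.
have hc : (\sum_(e : vpair n) (((val e).1 \in U) || ((val e).2 \in U)) <= 2 * #|U| * n)%N.
  pose E := [set e : vpair n | ((val e).1 \in U) || ((val e).2 \in U)].
  rewrite (_ : \sum_e _ = #|E|)%N; last first.
    rewrite -sum1_card [RHS]big_mkcond; apply: eq_bigr => e _.
    by rewrite inE; case: (_ || _).
  rewrite -(card_imset _ val_inj).
  apply: (@leq_trans #|setX U setT :|: setX setT U|).
    apply/subset_leq_card/subsetP => _ /imsetP[e + ->].
    by rewrite !inE !andbT.
  by rewrite (leq_trans (leq_card_setU _ _)) // !cardsX cardsT card_ord; lia.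
have n0 : 0 < n%:R :> R by rewrite ltr0n.
apply: (@le_trans _ _ (2 * gamma * (d / n%:R) * (2 * #|U| * n)%:R)).
  by apply: ler_wpM2l; rewrite ?ler_nat // mulr_ge0 ?divr_ge0 ?mulr_ge0.
rewrite !natrM le_eqVlt; apply/orP; left; apply/eqP; field.
by rewrite gt_eqF.
Qed.

Lemma Pr_run_transfer (T : finType) (M : algorithm R n T) eps x U S :
  edge_private eps M -> 0 <= eps ->
  Pr_run (SBM hp (flip U x)) M S ^+ 2 <=
    expR (4 * gamma * d * #|U|%:R * (expR eps - 1)) * Pr_run (SBM hp x) M S.
Proof.
move=> priv eps0.
have w1 : 1 <= expR eps by rewrite -expR0 ler_expR.
apply: (le_trans (@bern_set_transfer R _ (edge_prob d gamma (flip U x))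
  (edge_prob d gamma x) (expR eps) (fun G => Pr (M G) S) _ _ w1 _ _)).
- exact: hp.
- exact: hp.
- by move=> G; rewrite Pr_ge0 Pr_le1.
- by move=> G H; exact: group_privacy.
apply: ler_wpM2r.
  by apply: sumr_ge0 => G _; rewrite mulr_ge0 ?Pr_ge0 //; exact: (sbm_pmf_ge0 hp).
rewrite ler_expR mulrC; apply: ler_wpM2r; first by rewrite subr_ge0.
exact: sum_edge_prob_flip.
Qed.

End SBM.

(** * Hamming balls up to a global sign *)

Section Hamming.
Variable n : nat.
Implicit Types (x y : signvec n) (U V : {set 'I_n}).

Lemma Ham_triangle y x z : (Ham x z <= Ham y x + Ham y z)%N.
Proof.
apply: leq_trans (leq_card_setU _ _); apply/subset_leq_card/subsetP => i.
by rewrite !inE; case: (x i); case: (y i); case: (z i).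
Qed.

Lemma Ham_oppr x y : (Ham x y + Ham x (oppv y) = n)%N.
Proof.
rewrite -[RHS]card_ord -(cardsC [set i | x i != y i]); congr addn.
by apply: eq_card => i; rewrite !inE ffunE; case: (x i); case: (y i).
Qed.

Lemma Ham_oppl x y : (Ham x y + Ham (oppv x) y = n)%N.
Proof.
rewrite -[RHS]card_ord -(cardsC [set i | x i != y i]); congr addn.
by apply: eq_card => i; rewrite !inE ffunE; case: (x i); case: (y i).
Qed.

Lemma Ham_flip x y U : Ham y (flip U x) = #|symd [set i | y i != x i] U|.
Proof.
apply: eq_card => i; rewrite in_symd !inE ffunE.
by case: (x i); case: (y i); case: (i \in U).
Qed.

Lemma card_small_sets_le (T : finType) m :
  (#|[set U : {set T} | (#|U| < m)%N]| <= \sum_(j < m) 'C(#|T|, j))%N.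
Proof.
elim: m => [|m IHm].
  by rewrite big_ord0 leqn0 cards_eq0; apply/eqP/setP => U; rewrite !inE.
rewrite big_ord_recr /= -(card_draws T m).
apply: leq_trans (leq_add IHm (leqnn _)); apply: leq_trans (leq_card_setU _ _).
by apply/subset_leq_card/subsetP => U; rewrite !inE ltnS leq_eqVlt orbC.
Qed.

Lemma symd_inj (T : finType) (V : {set T}) : injective (symd V).
Proof.
move=> A B /setP e; apply/setP => i; have := e i; rewrite !in_symd.
by case: (i \in V); case: (i \in A); case: (i \in B).
Qed.

(** Symmetric difference with the disagreement set of [y] and [x] injects the good [U] into small
    sets; the factor 2 accounts for the global sign. *)
Lemma card_flip_near_le x y m :
  (#|[set U | (Ham y (flip U x) < m) || (Ham y (oppv (flip U x)) < m)]| <=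
   2 * \sum_(j < m) 'C(n, j))%N.
Proof.
have near z : (#|[set U | Ham z (flip U x) < m]| <= \sum_(j < m) 'C(n, j))%N.
  have := card_small_sets_le 'I_n m; rewrite card_ord; apply: leq_trans.
  rewrite -(card_imset _ (@symd_inj _ [set i | z i != x i])).
  apply/subset_leq_card/subsetP => _ /imsetP[U + ->].
  by rewrite !inE Ham_flip.
rewrite mulSn mul1n; apply: leq_trans (leq_add (near y) (near (oppv y))).
apply: leq_trans (leq_card_setU _ _); apply/subset_leq_card/subsetP => U.
rewrite !inE (_ : Ham y (oppv _) = Ham (oppv y) (flip U x)) //.
by have := Ham_oppl y (flip U x); have := Ham_oppr y (flip U x); lia.
Qed.

(** Otherwise the triangle inequality would put [x] within distance less than [2 * m] of [z] or of
    [oppv z]. *)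
Lemma far_not_near x z y m : (2 * m <= Ham x z)%N -> (Ham x z + 2 * m <= n)%N ->
  ~~ [&& (Ham y x < m) || (Ham y (oppv x) < m)
       & (Ham y z < m) || (Ham y (oppv z) < m)]%N.
Proof.
move=> h1 h2.
have := Ham_triangle y x z; have := Ham_triangle y (oppv x) z.
have := Ham_triangle y x (oppv z); have := Ham_triangle y (oppv x) (oppv z).
have := Ham_oppr x z; have := Ham_oppl x z; have := Ham_oppr (oppv x) z.
lia.
Qed.

Lemma balanced_card x N : n = (2 * N)%N -> #|[set i | x i]| = N -> balanced x.
Proof.
move=> nN xN; rewrite /balanced (bigID (fun i => x i)) /=.
have xN' : #|[set i | ~~ x i]| = N.
  have := cardsC [set i | x i]; rewrite card_ord xN.
  by rewrite (_ : ~: _ = [set i | ~~ x i]); [lia | apply/setP => i; rewrite !inE].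
rewrite (eq_bigr (fun=> -1)); last by move=> i xi; rewrite /sgn xi.
rewrite [X in _ + X](eq_bigr (fun=> 1)); last first.
  by move=> i /negbTE xi; rewrite /sgn xi.
rewrite !sumr_const.
rewrite -[X in -1 *+ X]cardsE -[X in 1 *+ X]cardsE.
by rewrite xN xN' mulNrn addNr.
Qed.

End Hamming.

(** * The family of balanced swaps *)

Section Packing.
Variables (n N : nat) (nN : n = (2 * N)%N).

Lemma half_set_exists : exists P : {set 'I_n}, #|P| = N.
Proof.
have : (0 < #|[set P : {set 'I_n} | #|P| == N]|)%N.
  by rewrite card_draws card_ord bin_gt0 nN; lia.
by case/card_gt0P => P; rewrite inE => /eqP; exists P.
Qed.

Variables (P : {set 'I_n}) (cardP : #|P| = N).

(** The reference vector x0: +1 on [P] and -1 outside, since [true] encodes -1. *)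
Definition half_signs : signvec n := [ffun i => i \notin P].

Lemma card_compl_half : #|~: P| = N.
Proof. by have := cardsC P; rewrite card_ord cardP; lia. Qed.

(** In a pair (A, B), A lists the +1 positions to flip and B the -1 positions; equal sizes preserve
    balance. *)
Definition swaps k : {set {set 'I_n} * {set 'I_n}} :=
  setX [set A : {set 'I_n} | A \subset P & #|A| == k]
       [set B : {set 'I_n} | B \subset ~: P & #|B| == k].

Lemma card_swaps k : #|swaps k| = ('C(N, k) ^ 2)%N.
Proof. by rewrite cardsX !cards_draws cardP card_compl_half mulnn. Qed.

Lemma card_swap k AB : AB \in swaps k -> #|AB.1 :|: AB.2| = (2 * k)%N.
Proof.
rewrite !inE => /andP[/andP[sA /eqP cA] /andP[sB /eqP cB]].
rewrite cardsU cA cB (_ : _ :&: _ = set0) ?cards0; first by rewrite subn0 mul2n addnn.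
apply/eqP; rewrite setI_eq0 disjoint_sym; apply: disjointWr sA _.
by rewrite disjoints_subset.
Qed.

(** The two components are recovered by intersecting the union with [P] and with its complement. *)
Lemma swap_inj k : {in swaps k &, injective (fun AB => AB.1 :|: AB.2)}.
Proof.
move=> [A B] [A' B']; rewrite !inE /=.
move=> /andP[/andP[/subsetP sA _] /andP[/subsetP sB _]].
move=> /andP[/andP[/subsetP sA' _] /andP[/subsetP sB' _]] /setP e.
by congr pair; apply/setP => i; have := e i; rewrite !inE;
  have := sA i; have := sB i; have := sA' i; have := sB' i; rewrite !inE;
  case: (i \in A); case: (i \in B); case: (i \in A'); case: (i \in B');
  case: (i \in P) => //= h1 h2 h3 h4 //;
  by [have := h1 isT | have := h2 isT
     | have := h3 isT | have := h4 isT].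
Qed.

Lemma balanced_swap k AB :
  AB \in swaps k -> balanced (flip (AB.1 :|: AB.2) half_signs).
Proof.
rewrite !inE => /andP[/andP[/subsetP sA /eqP cA] /andP[/subsetP sB /eqP cB]].
apply: (balanced_card nN).
rewrite (_ : [set i | _] = AB.1 :|: (~: P :\: AB.2)); last first.
  apply/setP => i; rewrite !inE !ffunE !inE.
  have := sA i; have := sB i; rewrite !inE.
  case: (i \in AB.1); case: (i \in AB.2); case: (i \in P) => //= h1 h2;
  by [have := h1 isT | have := h2 isT].
rewrite cardsU cardsD cA (setIidPr _); last by apply/subsetP.
rewrite (_ : AB.1 :&: _ = set0); last first.
  apply/setP => i; rewrite !inE; have := sA i.
  by case: (i \in AB.1) => //= ->; rewrite ?andbF.
have := subset_leq_card (introT subsetP sB).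
by rewrite cards0 card_compl_half cB; lia.
Qed.

Lemma balanced_half : balanced half_signs.
Proof.
apply: (balanced_card nN); rewrite -card_compl_half; apply: eq_card => i.
by rewrite !inE ffunE.
Qed.

End Packing.

(** * From counting to exponential bounds *)

Section LowerBound.
Variable R : realType.

Lemma pow_ratio_le (a b c E X Y : R) k : 0 < a -> 0 <= X -> 0 < Y -> 0 <= E ->
  b ^+ 2 <= E * c -> c <= a ^+ 2 -> a * X ^+ k <= b * Y ^+ k ->
  (X / Y) ^+ (k * 2) <= E.
Proof.
move=> a0 X0 Y0 E0 h h1 h2.
rewrite expr_div_n !exprM ler_pdivrMr; last by rewrite !exprn_gt0.
have a20 : 0 < a ^+ 2 by rewrite exprn_gt0.
rewrite -(ler_pM2l a20) -exprMn.
apply: (@le_trans _ _ ((b * Y ^+ k) ^+ 2)).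
  have aX0 : 0 <= a * X ^+ k by rewrite mulr_ge0 ?exprn_ge0 // ltW.
  by apply: lerXn2r; rewrite ?nnegrE // (le_trans aX0).
rewrite exprMn [leRHS]mulrA; apply: ler_wpM2r; first by rewrite !exprn_ge0 // ltW.
by rewrite mulrC (le_trans h) // ler_wpM2l.
Qed.

(** Going up to [2 * m.+1] already pays for the overcount, by [bin_ball_le]. The remaining [m.+1]
    steps up to [3 * m.+1], squared, yield the exponent [2 * m.+1]. *)
Lemma binomial_gap (N m : nat) (E : R) : (13 <= N)%N -> (25 * m <= 2 * N)%N ->
  (0 < m)%N -> 0 <= E ->
  ('C(N, 3 * m.+1) ^ 2)%:R <= E * (16 * N ^ 2 * 'C(2 * N, m))%:R ->
  ((N%:R - 3 * m.+1%:R) / (3 * m.+1%:R)) ^+ (2 * m.+1) <= E.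
Proof.
move=> N13 mN m0 E0 h.
have h1 : ((16 * N ^ 2 * 'C(2 * N, m))%:R : R) <= ('C(N, 2 * m.+1) ^ 2)%:R.
  by rewrite ler_nat; apply: bin_ball_le.
have h2 : (('C(N, 2 * m.+1) * (N - 3 * m.+1) ^ m.+1)%:R : R) <=
           ('C(N, 3 * m.+1) * (3 * m.+1) ^ m.+1)%:R.
  have := @bin_ratio_ge N (2 * m.+1) m.+1.
  by rewrite (_ : 2 * m.+1 + m.+1 = 3 * m.+1)%N ?ler_nat; [apply; lia | lia].
have a0 : 0 < ('C(N, 2 * m.+1))%:R :> R by rewrite ltr0n bin_gt0; lia.
have -> : N%:R - 3 * m.+1%:R = (N - 3 * m.+1)%:R :> R.
  by rewrite natrB ?natrM //; lia.
rewrite -natrM (mulnC 2).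
apply: (pow_ratio_le a0 _ _ E0 (c := (16 * N ^ 2 * 'C(2 * N, m))%:R)
  (b := 'C(N, 3 * m.+1)%:R)) => //.
- by rewrite -natrX.
- by rewrite -natrX.
- by rewrite -!natrX -!natrM.
Qed.

(* For u = (t - 3) / 3 with t = N / (m + 1), as below, the left-hand side is 4 t,
   a bound for 1 / zeta. *)
Lemma le_pow22 (u : R) : 7 / 6 <= u -> 12 * u + 12 <= u ^+ 22.
Proof.
move=> hu.
(* Since 2.9^3 > 23, u^22 is at least 23 u, which exceeds 12 u + 12 because 11 u >= 12. *)
have h7 : 29 / 10 <= u ^+ 7.
  have : (7 / 6) ^+ 7 <= u ^+ 7 by apply: lerXn2r; rewrite ?nnegrE; lra.
  rewrite !exprS expr0; lra.
have h21 : 23 <= u ^+ 21.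
  have : (29 / 10) ^+ 3 <= (u ^+ 7) ^+ 3 by apply: lerXn2r; rewrite ?nnegrE; lra.
  rewrite -exprM !exprS expr0; lra.
by rewrite exprS; nra.
Qed.

Lemma near_of_err n (x y : signvec n) (zeta : R) m : (0 < n)%N ->
  zeta * n%:R <= m%:R -> err R y x < zeta ->
  ((Ham y x < m) || (Ham y (oppv x) < m))%N.
Proof.
move=> n0 zm; rewrite /err mulrC ltr_pdivrMr ?ltr0n // => /lt_le_trans/(_ zm).
by rewrite ltr_nat gtn_min.
Qed.

(** * The packing and two-point bounds for a fixed algorithm *)

Section Fixed.
Variables (n N : nat) (d gamma zeta eta eps : R) (hp : sbm_params n d gamma).
Variables (M : algorithm R n (signvec n)).
Hypotheses (nN : n = (2 * N)%N) (N13 : (13 <= N)%N) (d_gt0 : 0 < d).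
Hypotheses (gamma_gt0 : 0 < gamma) (priv : edge_private eps M).
Hypothesis accurate : forall x : signvec n, balanced x ->
  1 - eta <= Pr_run (SBM hp x) M [set y | err R y x < zeta].
Variable m : nat.
Hypotheses (m_gt0 : (0 < m)%N) (mN : (25 * m <= 2 * N)%N).
Hypothesis (zm : zeta * n%:R <= m.+1%:R).

Let n_gt0 : (0 < n)%N. Proof. by lia. Qed.

Let near (x : signvec n) := [set y | err R y x < zeta].

(** A swap flips [2 * k] signs, which turns the factor [4 * gamma * d * #|U|] of the transfer bound
    into [8 * gamma * d * k]. *)
Lemma near_swap_lower (P : {set 'I_n}) (hP : #|P| = N) k AB :
  0 <= 1 - eta -> AB \in swaps P k ->
  (1 - eta) ^+ 2 <= expR (8 * gamma * d * k%:R * (expR eps - 1)) *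
    Pr_run (SBM hp (half_signs P)) M (near (flip (AB.1 :|: AB.2) (half_signs P))).
Proof.
move=> eta1 hAB; set x := flip _ _.
have eps0 : 0 <= eps by apply: (edge_private_eps_ge0 _ priv); lia.
have acc := accurate (balanced_swap nN hP hAB).
have := Pr_run_transfer hp n_gt0 (ltW d_gt0) (ltW gamma_gt0) (half_signs P)
  (AB.1 :|: AB.2) (near x) priv eps0.
rewrite (card_swap hAB) natrM.
rewrite (_ : 4 * gamma * d * (2 * k%:R) = 8 * gamma * d * k%:R); last by ring.
apply: le_trans.
by rewrite ler_pXn2r ?nnegrE // (le_trans eta1 acc).
Qed.

Lemma packing_bound : 1 / n%:R <= 1 - eta ->
  ('C(N, 3 * m.+1) ^ 2)%:R <=
  expR (24 * gamma * d * m.+1%:R * (expR eps - 1)) * (16 * N ^ 2 * 'C(2 * N, m))%:R.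
Proof.
move=> hguess; have [P hP] := half_set_exists nN.
have n0 : 0 < n%:R :> R by rewrite ltr0n.
have eta1 : 0 <= 1 - eta by apply: le_trans hguess; rewrite divr_ge0.
set E := expR _.
have hb y : (#|[set AB in swaps P (3 * m.+1) |
      y \in near (flip (AB.1 :|: AB.2) (half_signs P))]| <= 4 * 'C(n, m))%N.
  (* The 4 is 2 for the global sign times 2 from the geometric sum. *)
  apply: (@leq_trans (2 * \sum_(j < m.+1) 'C(n, j))); last first.
    by rewrite -[4%N]/(2 * 2)%N -mulnA leq_mul2l /= sum_bin_le //; lia.
  apply: leq_trans (card_flip_near_le (half_signs P) y m.+1).
  rewrite -(@card_in_imset _ _ (fun AB => AB.1 :|: AB.2)); last first.
    by move=> AB AB' /setIdP[h _] /setIdP[h' _]; exact: (swap_inj h h').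
  apply/subset_leq_card/subsetP => _ /imsetP[AB + ->].
  by case/setIdP => _; rewrite !inE; exact: near_of_err.
have := sum_Pr_run_le (SBM hp (half_signs P)) M hb.
(* [hguess] replaces [(1 - eta) ^+ 2] by 1 / n^2. *)
have low AB : AB \in swaps P (3 * m.+1) -> (n%:R ^+ 2)^-1 / E <=
    Pr_run (SBM hp (half_signs P)) M (near (flip (AB.1 :|: AB.2) (half_signs P))).
  move=> hAB; rewrite ler_pdivrMr ?expR_gt0 // mulrC.
  have := near_swap_lower hP eta1 hAB.
  rewrite natrM.
  rewrite (_ : 8 * gamma * d * (3 * m.+1%:R) = 24 * gamma * d * m.+1%:R);
    last by ring.
  apply: le_trans.
  by rewrite -exprVn ler_pXn2r ?nnegrE ?invr_ge0 // -div1r.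
move=> up; have := le_trans (ler_sum _ low) up.
rewrite sumr_const (card_swaps nN hP) -[_ *+ _]mulr_natl.
rewrite mulrA ler_pdivrMr ?expR_gt0 // ler_pdivrMr ?exprn_gt0 //.
move/le_trans; apply.
rewrite (mulrC _ E) -mulrA -natrX -natrM ler_wpM2l ?expR_ge0 // ler_nat nN.
by rewrite expnMn; lia.
Qed.

(** Vectors differing by [m.+1] swaps are at distance [2 * m.+1], so their success events are
    disjoint; the event of [z] thus has mass at most [eta] under [x]. *)
Lemma two_point_bound : 0 <= 1 - eta ->
  (1 - eta) ^+ 2 <= expR (8 * gamma * d * m.+1%:R * (expR eps - 1)) * eta.
Proof.
move=> eta1; have [P hP] := half_set_exists nN.
have /card_gt0P[AB hAB] : (0 < #|swaps P m.+1|)%N.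
  by rewrite (card_swaps nN hP) expn_gt0 bin_gt0 orbC; apply/orP; right; lia.
apply: (le_trans (near_swap_lower hP eta1 hAB)).
apply: ler_wpM2l; first exact: expR_ge0.
set x := half_signs P; set z := flip _ _.
have : Pr_run (SBM hp x) M (near x) + Pr_run (SBM hp x) M (near z) <= 1.
  apply: Pr_runU_disjoint_le1; apply/pred0P => y; apply/negP; rewrite /= !inE.
  case/andP => /(near_of_err n_gt0 zm) h1 /(near_of_err n_gt0 zm) h2.
  have hxz : Ham x z = (2 * m.+1)%N.
    rewrite Ham_flip -(card_swap hAB); apply: eq_card => i.
    by rewrite in_symd !inE eqxx; case: (_ || _).
  have := @far_not_near _ x z y m.+1; rewrite hxz h1 h2.
  by move=> /(_ (leqnn _)) h; suff : false by []; apply: h; lia.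
have := accurate (balanced_half nN hP); rewrite -/x -/(near x); lra.
Qed.

End Fixed.
End LowerBound.

(** * Choice of parameters and assembly of the two terms *)

Theorem theorem5p22 (R : realType) :
  exists c : R, 0 < c /\
  forall (n : nat) (d gamma zeta eta eps : R)
    (n_gt0 : (0 < n)%N) (n_even : ~~ odd n)
    (d_gt0 : 0 < d) (gamma_gt0 : 0 < gamma)
    (hp : sbm_params n d gamma)
    (hzeta : 1 / n%:R <= zeta <= 4 / 100)
    (heta : 0 < eta < 1)
    (hguess : 1 / n%:R <= 1 - eta),
  (exists M : algorithm R n (signvec n),
     edge_private eps M /\
     forall x : signvec n, balanced x ->
       1 - eta <= Pr_run (SBM hp x) M [set y | err R y x < zeta]) ->
  c * (ln (1 / zeta) / (gamma * d) + ln (1 / eta) / (zeta * n%:R * gamma * d))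
    <= expR (2 * eps) - 1.
Proof.
(* 528 = 2 * 264: each of the two terms is shown to be at most [264 * B]. *)
exists 528^-1; split; first by rewrite invr_gt0.
move=> n d gamma zeta eta eps n_gt0 n_even d_gt0 gamma_gt0 hp.
move=> /andP[zeta_ge zeta_le] /andP[eta_gt0 eta_lt1] hguess [M [priv accurate]].
have n0 : 0 < n%:R :> R by rewrite ltr0n.
have zn_ge1 : 1 <= zeta * n%:R by rewrite -ler_pdivrMr.
have zeta_gt0 : 0 < zeta by apply: lt_le_trans zeta_ge; rewrite divr_gt0.
(* From 1 <= [zeta * n] <= n / 25; evenness then gives n >= 26. *)
have n25 : (25 <= n)%N by rewrite -(ler_nat R); nra.
have [N nN] : exists N, n = (2 * N)%N by exists n./2; rewrite mul2n even_halfK.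
have N13 : (13 <= N)%N by clear -n25 nN; lia.
pose m := Num.truncn (zeta * n%:R).
have /andP[mz zm] : m%:R <= zeta * n%:R < m.+1%:R by apply: truncn_itv; lra.
have m_gt0 : (0 < m)%N by rewrite /m truncn_gt0.
have mN : (25 * m <= 2 * N)%N.
  by rewrite -nN -(ler_nat R) natrM; nra.
have m1z : m.+1%:R <= 2 * (zeta * n%:R).
  by apply: (@le_trans _ _ (2 * m%:R)); [rewrite -natrM ler_nat; clear -m_gt0; lia | lra].
have eps0 : 0 <= eps by apply: (edge_private_eps_ge0 _ priv); apply: leq_trans _ n25.
set B := expR eps - 1.
have B0 : 0 <= B by rewrite subr_ge0 -expR0 ler_expR.
have m10 : 0 < m.+1%:R :> R by rewrite ltr0n.
set u : R := (N%:R - 3 * m.+1%:R) / (3 * m.+1%:R).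
have uE : N%:R = 3 * m.+1%:R * (u + 1).
  by rewrite mulrDr mulr1 mulrC divfK ?subrK // gt_eqF // mulr_gt0.
(* For [m = 1] the bound [13 * m.+1 <= 2 * N] is [N13]; for larger [m] it follows from [mN]. *)
have u_ge : 7 / 6 <= u.
  have : 13 * m.+1%:R <= 2 * N%:R :> R 
    by rewrite -!natrM ler_nat; clear -mN N13 m_gt0; lia.
  rewrite uE; nra.
have u0 : 0 < u by apply: lt_le_trans u_ge; rewrite divr_gt0.
(* By [m1z], 1 / zeta is at most [4 * N / m.+1], which equals 12 u + 12. *)
have zeta_u : 1 / zeta <= u ^+ 22.
  apply: le_trans (le_pow22 u_ge); rewrite ler_pdivrMr //.
  have : n%:R = 2 * N%:R :> R by rewrite -natrM nN.
  rewrite uE => nE; move: m1z; rewrite nE; nra.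
have gd0 : 0 < gamma * d by rewrite mulr_gt0.
(* 264 = 22 * 12: the packing bound gives [ln u <= 12 * (gamma * d * B)]. *)
have L_le : ln (1 / zeta) <= 264 * (gamma * d * B).
  apply: (@le_trans _ _ (ln (u ^+ 22))).
    by rewrite ler_ln ?posrE ?exprn_gt0 // divr_gt0.
  rewrite lnXn // -[_ *+ 22]mulr_natl.
  have E0 := expR_ge0 (24 * gamma * d * m.+1%:R * B).
  have h : u ^+ (2 * m.+1) <= expR (24 * gamma * d * m.+1%:R * B).
    apply: (binomial_gap N13 mN m_gt0 E0).
    exact: (packing_bound nN N13 d_gt0 gamma_gt0 priv accurate m_gt0 mN (ltW zm)).
  have : ln (u ^+ (2 * m.+1)) <= 24 * gamma * d * m.+1%:R * B.
    by rewrite -[leRHS]expRK ler_ln ?posrE ?exprn_gt0 ?expR_gt0.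
  rewrite lnXn // -[_ *+ (2 * _)]mulr_natl natrM; set l := ln u => {}h.
  have : m.+1%:R * l <= m.+1%:R * (12 * (gamma * d * B)) by lra.
  rewrite ler_pM2l //; lra.
have L_ge : ln 4 <= ln (1 / zeta).
  rewrite ler_ln ?posrE ?divr_gt0 // ler_pdivlMr //; lra.
have T_le : ln (1 / eta) <= 264 * (zeta * n%:R * gamma * d * B).
  have gdB : 0 <= gamma * d * B by rewrite mulr_ge0 // ltW.
  (* For large [eta], ln (1 / eta) <= ln 4 <= ln (1 / zeta), and [zeta * n >= 1] allows reuse of
     [L_le]. *)
  have [eta_big | eta_small] := ltP (1 / 4) eta.
    have h1 : ln (1 / eta) <= ln 4.
      rewrite ler_ln ?posrE ?divr_gt0 // ler_pdivrMr //; lra.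
    have h2 : gamma * d * B <= (zeta * n%:R) * (gamma * d * B) by rewrite ler_peMl.
    lra.
  have := two_point_bound nN N13 d_gt0 gamma_gt0 priv accurate m_gt0 mN (ltW zm).
  rewrite -/B; set Y := 8 * gamma * d * m.+1%:R * B => h.
  have {}h : (1 - eta) ^+ 2 <= expR Y * eta by apply: h; lra.
  have E0 := expR_gt0 Y.
  (* Squaring 9/16 <= e^Y eta and using eta^2 <= eta / 4 gives e^(2Y) eta >= 81/64. *)
  have h1 : 1 / eta <= expR (2 * Y).
    rewrite ler_pdivrMr // (_ : 2 * Y = Y + Y) ?expRD; last by ring.
    have h2 : 9 / 16 <= expR Y * eta by apply: le_trans h; nra.
    have : (9 / 16) ^+ 2 <= (expR Y * eta) ^+ 2.
      by apply: lerXn2r; rewrite ?nnegrE; lra.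
    nra.
  have : ln (1 / eta) <= 2 * Y.
    by rewrite -[leRHS]expRK ler_ln ?posrE ?divr_gt0 ?expR_gt0.
  have h2 : m.+1%:R * (gamma * d * B) <= 2 * (zeta * n%:R) * (gamma * d * B).
    by rewrite ler_wpM2r.
  have h3 : 0 <= zeta * n%:R * (gamma * d * B) by rewrite mulr_ge0 // ltW // mulr_gt0.
  rewrite /Y; lra.
have B_le : B <= expR (2 * eps) - 1.
  by rewrite lerD2r ler_expR; lra.
apply: le_trans B_le.
have zngd0 : 0 < zeta * n%:R * gamma * d by rewrite !mulr_gt0.
have h1 : ln (1 / zeta) / (gamma * d) <= 264 * B by rewrite ler_pdivrMr //; lra.
have h2 : ln (1 / eta) / (zeta * n%:R * gamma * d) <= 264 * B.
  by rewrite ler_pdivrMr //; lra.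
by lra.
Qed.
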